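(* Let $K$ be a field, $f\in K[x]$, and let $d$ be the greatest proper divisor of $\deg f$ (the largest positive divisor of $\deg f$ smaller than $\deg f$). If $f$ has at least $d$ simple critical values, then $f$ is prime over $K$.
   Context: Let $t$ be an indeterminate. For $u(x)=a_nx^n+\cdots$ and $v(x)=b_mx^m+\cdots$, $\operatorname{Res}_x(u,v)=a_n^m b_m^n\prod_{\alpha,\beta}(\alpha-\beta)$ over the roots $\alpha$ of $u$ and $\beta$ of $v$ in an algebraic closure, and the discriminant of $u$ (degree $n$, leading coefficient $a_n$) is $D[u]=\frac{(-1)^{n(n-1)/2}}{a_n}\operatorname{Res}_x(u,u')$. An element $b\in\overline{K}$ is a critical value of $f$ iff it is a root of the polynomial $D[f-t]\in K[t]$; its multiplicity is its multiplicity as a root of $D[f-t]$, and a simple critical value is one of multiplicity $1$. $f\in K(x)$ is composite over $K$ if $f=g\circ h$ for some $g,h\in K(x)$ with $\deg g,\deg h\ge2$ (where $\deg(u_1/u_2)=\max\{\deg u_1,\deg u_2\}$ for coprime $u_1,u_2$), and prime over $K$ otherwise. *)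

(* Defs.v *)
From HB Require Import structures.
From mathcomp Require Import all_boot all_order all_algebra.
From mathcomp Require Import ring zify.

Set Implicit Arguments.
Unset Strict Implicit.
Unset Printing Implicit Defensive.

Import GRing.Theory.
Local Open Scope ring_scope.

(* MathComp's Sylvester matrix lists coefficients in increasing degree, so that
   [resultant u v] is b_m^n a_n^m prod (beta - alpha); the sign restores
   a_n^m b_m^n prod (alpha - beta), see [Res_roots] below. *)
Definition Res (R : nzRingType) (u v : {poly R}) : R :=
  (-1) ^+ ((size u).-1 * (size v).-1) * resultant u v.

(* The degree of u^`() is its actual degree, which may be smaller than
   deg u - 1 in positive characteristic; if deg u > 0 and u^`() = 0 then
   discr u = 0. *)
Definition discr (R : idomainType) (u : {poly R}) : R :=
  let n := (size u).-1 in
  (-1) ^+ (n * n.-1)./2 / lead_coef u * Res u u^`().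

(* The discriminant D[f - t] with respect to x, as a polynomial in t: the outer
   variable of {poly {poly K}} is x, the inner one is t.  The division by the
   leading coefficient takes place in K[t], where it is by a nonzero constant
   when f is not constant, see [lead_coef_subt]. *)
Definition discr_subt (K : fieldType) (f : {poly K}) : {poly K} :=
  discr (f^:P - 'X%:P).

Section CriticalValues.
Variables (K L : fieldType) (iota : {rmorphism K -> L}) (f : {poly K}).

Definition critical_value (b : L) : Prop :=
  root (map_poly iota (discr_subt f)) b.

(* [mup] of the zero polynomial is 0, so there is no simple critical value when
   D[f - t] = 0. *)
Definition simple_critical_value (b : L) : Prop :=
  critical_value b /\ mup b (map_poly iota (discr_subt f)) = 1%N.

Definition at_least_simple_critical_values (d : nat) : Prop :=
  exists s : seq L,
    [/\ uniq s, (d <= size s)%N & forall b, b \in s -> simple_critical_value b].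

End CriticalValues.

Definition is_algebraic_closure (K : fieldType) (L : closedFieldType)
  (iota : {rmorphism K -> L}) : Prop := forall x : L, algebraicOver iota x.

Definition greatest_proper_divisor (d n : nat) : Prop :=
  [/\ (0 < d)%N, (d %| n)%N, (d < n)%N &
      forall e : nat, (0 < e)%N -> (e %| n)%N -> (e < n)%N -> (e <= d)%N].

Notation "x %:F" := (@FracField.tofrac _ x).

Section RationalFunctions.
Variable K : fieldType.
Local Notation Kx := {fraction {poly K}}.

(* Numerator and denominator in lowest terms, see [rnum_rden]. *)
Definition rnum (r : Kx) : {poly K} :=
  let q := generic_quotient.repr r in \n_q %/ gcdp \n_q \d_q.
Definition rden (r : Kx) : {poly K} :=
  let q := generic_quotient.repr r in \d_q %/ gcdp \n_q \d_q.

Definition rdeg (r : Kx) : nat := maxn (size (rnum r)).-1 (size (rden r)).-1.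

Definition reval (p : {poly K}) (h : Kx) : Kx :=
  (map_poly (@FracField.tofrac {poly K} \o polyC) p).[h].

(* The denominator only vanishes for some constant h. *)
Definition rcomp (g h : Kx) : Kx := reval (rnum g) h / reval (rden g) h.

Definition composite_over (r : Kx) : Prop :=
  exists g h : Kx, [/\ r = rcomp g h, (2 <= rdeg g)%N & (2 <= rdeg h)%N].

Definition prime_over (r : Kx) : Prop := ~ composite_over r.

Lemma rnum_rden (r : Kx) :
  [/\ rden r != 0, coprimep (rnum r) (rden r) & r = (rnum r)%:F / (rden r)%:F].
Proof.
rewrite /rnum /rden; set q := generic_quotient.repr r.
have dq0 : \d_q != 0 by exact: denom_ratioP.
set g := gcdp _ _; have g0 : g != 0 by rewrite gcdp_eq0 negb_and dq0 orbT.
have En : \n_q = \n_q %/ g * g by rewrite divpK ?dvdp_gcdl.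
have Ed : \d_q = \d_q %/ g * g by rewrite divpK ?dvdp_gcdr.
have d0 : \d_q %/ g != 0.
  by apply: contraNneq dq0 => E; rewrite Ed E mul0r.
split=> //; first by rewrite coprimep_div_gcd // dq0 orbT.
have dF0 : (\d_q)%:F != 0 by rewrite tofrac_eq0.
apply: (mulIf dF0).
have -> : r * (\d_q)%:F = (\n_q)%:F.
  rewrite -[r in LHS](generic_quotient.reprK r) -/q; unlock FracField.tofrac.
  rewrite -[LHS]FracField.pi_mul; apply/generic_quotient.eqmodP.
  rewrite /= FracField.equivfE /FracField.mulf.
  by rewrite !numden_Ratio ?mulf_neq0 ?oner_neq0 // !mulr1 mulrC.
have gd : (\d_q)%:F = (\d_q %/ g)%:F * g%:F by rewrite -tofracM -Ed.
by rewrite gd mulrA divfK ?tofrac_eq0 // -tofracM -En.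
Qed.

End RationalFunctions.

Lemma lead_coef_subt (K : fieldType) (f : {poly K}) : (1 < size f)%N ->
  lead_coef (f^:P - 'X%:P) = (lead_coef f)%:P.
Proof.
move=> f1; rewrite lead_coefDl ?lead_coef_map_inj //; first exact: polyC_inj.
by rewrite size_polyN size_polyC polyX_eq0 (size_map_inj_poly (@polyC_inj _)).
Qed.

(* The rows are X^i p for i < l, then X^i q; with N and l free, this allows an
   induction on the roots of p without casts. *)
Definition Syl (R : nzRingType) (N l : nat) (p q : {poly R}) : 'M[R]_N :=
  \matrix_(i, j) (if (i < l)%N then 'X^i * p else 'X^(i - l) * q)`_j.

Lemma resultant_Syl (R : nzRingType) (p q : {poly R}) :
  resultant p q = \det (Syl ((size q).-1 + (size p).-1) (size q).-1 p q).
Proof.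
congr (\det _); apply/matrixP=> i j.
rewrite Sylvester_mxE !mxE; case: split_ordP => k -> /=.
  by rewrite coefXnM ltnNge if_neg -mulrb.
by rewrite addKn coefXnM ltnNge if_neg -mulrb.
Qed.

Section Step.
Variables (R : comNzRingType) (N l : nat) (a : R) (u v w : {poly R}).
Hypotheses (vE : v = v.[a]%:P + ('X - a%:P) * w) (lN : (l <= N)%N).
Hypotheses (szu : (size u <= (N - l).+1)%N) (szw : (size w <= l)%N).
Hypothesis (szv : (size v <= l.+1)%N).

Lemma Syl_step : \det (Syl N.+1 l (('X - a%:P) * u) v) =
  (-1) ^+ l * v.[a] * \det (Syl N l u v).
Proof.
pose P (i : nat) : {poly R} :=
  if (i < l)%N then 'X^i * (('X - a%:P) * u) else 'X^(i - l) * v.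
pose c (i : nat) : R := v.[a] *+ (i == l).
pose q (i : nat) : {poly R} := if (i < l)%N then 'X^i * u else
   if i == l then w else 'X^(i - l.+1) * v.
pose B : 'M[R]_N.+1 := \matrix_(i, j) ((c i)%:P + 'X * q i)`_j.
pose E : 'M[R]_N.+1 := \matrix_(i, j)
  ((j == i)%:R - a *+ ((l < i)%N && (j.+1 == i :> nat))).
pose U : 'M[R]_N.+1 := \matrix_(i, j) ((i == j)%:R - a *+ (i == j.+1 :> nat)).
have szq i : (i < N.+1)%N -> (size (q i) <= N)%N.
  move=> iN; have szX n (p : {poly R}) : (size ('X^n * p)%R <= n + size p)%N.
    by rewrite (leq_trans (size_polyMleq _ _)) // size_polyXn.
  rewrite /q; case: ltnP => il; first by apply: leq_trans (szX _ _) _; lia.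
  by case: eqP => il'; [lia | apply: leq_trans (szX _ _) _; lia].
have Pq i : P i - a%:P * P i.-1 *+ (l < i)%N = (c i)%:P + ('X - a%:P) * q i.
  rewrite /P /c /q; case: ltngtP => il /=.
  - by rewrite mulr0n subr0 add0r; ring.
  - have -> : (i.-1 < l)%N = false by lia.
    have -> : (i - l = (i - l.+1).+1)%N by lia.
    have -> : (i.-1 - l = (i - l.+1))%N by lia.
    by rewrite mulr0n mulr1n exprS; ring.
  - by rewrite il subnn expr0 mul1r mulr0n mulr1n subr0 -vE.
have EM : E *m Syl N.+1 l (('X - a%:P) * u) v = B *m U.
  apply/matrixP=> i j; rewrite !mxE.
  transitivity ((P i - a%:P * P i.-1 *+ (l < i)%N)`_j).
    rewrite coefB coefMn coefCM.
    rewrite (eq_bigr (fun k : 'I_N.+1 => (k == i)%:R * (P k)`_j -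
       a * (P k)`_j *+ ((l < i)%N && (k.+1 == i :> nat)))); last first.
      by move=> k _; rewrite !mxE mulrBl -/(P k) [in X in _ - X]mulrnAl.
    rewrite sumrB; congr (_ - _).
      rewrite (bigD1 i) //= eqxx mul1r big1 ?addr0 // => k /negPf ki.
      by rewrite ki mul0r.
    case: ltnP => li /=; last by rewrite big1.
    have iN : (i.-1 < N.+1)%N by case: i li => /= i; lia.
    have iE : (i.-1.+1 = i)%N by lia.
    rewrite (bigD1 (Ordinal iN)) //= iE eqxx big1 ?addr0 // => k.
    by rewrite -val_eqE /= -{2}iE eqSS => /negPf->.
  rewrite Pq mulrBl addrA coefB coefCM.
  rewrite (eq_bigr (fun k : 'I_N.+1 => ((c i)%:P + 'X * q i)`_k * (k == j)%:R -
       ((c i)%:P + 'X * q i)`_k * a *+ (k == j.+1 :> nat))); last first.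
    by move=> k _; rewrite !mxE mulrBr [in X in _ - X]mulrnAr.
  rewrite sumrB; congr (_ - _).
    rewrite (bigD1 j) //= eqxx mulr1 big1 ?addr0 // => k /negPf kj.
    by rewrite kj mulr0.
  case: (ltnP j.+1 N.+1) => jN.
    rewrite (bigD1 (Ordinal jN)) //= eqxx big1 ?addr0 => [|k].
      by rewrite mulr1n coefD coefC coefXM /= add0r mulrC.
    by rewrite -val_eqE /= => /negPf->.
  rewrite big1 => [|k _]; last first.
    by have kN := ltn_ord k; have -> : (k == j.+1 :> nat) = false by lia.
  by rewrite nth_default ?mulr0 // (leq_trans (szq i _)).
have dE : \det E = 1.
  rewrite det_trig; last first.
    apply/is_trig_mxP=> i j ij; rewrite mxE -val_eqE /=.
    have -> : (j == i :> nat) = false by lia.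
    have -> : (j.+1 == i :> nat) = false by lia.
    by rewrite andbF subr0.
  rewrite big1 // => i _; rewrite mxE eqxx.
  have -> : (i.+1 == i :> nat) = false by lia.
  by rewrite andbF subr0.
have dU : \det U = 1.
  rewrite det_trig; last first.
    apply/is_trig_mxP=> i j ij; rewrite mxE -val_eqE /=.
    have -> : (i == j :> nat) = false by lia.
    have -> : (i == j.+1 :> nat) = false by lia.
    by rewrite subr0.
  rewrite big1 // => i _; rewrite mxE eqxx.
  have -> : (i == i.+1 :> nat) = false by lia.
  by rewrite subr0.
have := congr1 determinant EM.
rewrite !det_mulmx dE dU mul1r mulr1 => ->.
have lN1 : (l < N.+1)%N by [].
rewrite (expand_det_col B ord0) (bigD1 (Ordinal lN1)) //= big1 => [|i].
  rewrite addr0 mxE coefD coefC coefXM /= addr0 /c eqxx mulr1n /cofactor addn0.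
  rewrite mulrCA mulrA; congr (_ * \det _).
  apply/matrixP=> i j; rewrite !mxE coefD coefC coefXM /= add0r /bump /= add0n.
  rewrite /q; case: (ltnP i l) => il.
    by rewrite add0n il.
  rewrite add1n; have -> : (i.+1 < l)%N = false by lia.
  have -> : (i.+1 == l) = false by lia.
  by rewrite subSS.
rewrite -val_eqE /= => /negPf il.
by rewrite mxE coefD coefC coefXM /= addr0 /c il mul0r.
Qed.
End Step.

Lemma Syl_prod (R : comNzRingType) (s : seq R) (l : nat) (a : R) (v : {poly R}) :
  (size v <= l.+1)%N ->
  \det (Syl (l + size s) l (a *: \prod_(x <- s) ('X - x%:P)) v) =
  (-1) ^+ (l * size s) * a ^+ l * \prod_(x <- s) v.[x].
Proof.
move=> szv; elim: s => [|x s IHs] /=.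
  rewrite !big_nil addn0 muln0 expr0 mul1r mulr1 det_trig; last first.
    apply/is_trig_mxP=> i j ij; rewrite mxE ltn_ord coefXnM.
    case: ltnP => // _; rewrite coefZ coef1.
    have -> : (j - i == 0)%N = false by lia.
    by rewrite mulr0.
  rewrite (eq_bigr (fun=> a)) ?prodr_const ?card_ord // => i _.
  by rewrite mxE ltn_ord coefXnM ltnn subnn coefZ coef1 mulr1.
have : root (v - v.[x]%:P) x by rewrite /root !hornerE subrr.
case/factor_theorem => w vw.
have vE : v = v.[x]%:P + ('X - x%:P) * w by rewrite mulrC -vw addrC subrK.
have szw : (size w <= l)%N.
  have [->|w0] := eqVneq w 0; first by rewrite size_poly0.
  have : (size (v - v.[x]%:P)%R <= l.+1)%N.
    rewrite (leq_trans (size_polyD _ _)) // geq_max szv size_polyN.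
    by rewrite (leq_trans (size_polyC_leq1 _)).
  by rewrite vw size_Mmonic ?monicXsubC // size_XsubC addn2.
rewrite !big_cons addnS scalerAr (Syl_step vE) ?leq_addr // ?IHs.
  by rewrite mulnS exprD; ring.
rewrite addKn (leq_trans (size_scale_leq _ _)) //.
by rewrite size_prod_XsubC.
Qed.

Lemma Res_split (R : idomainType) (a b : R) (A B : seq R) (u v : {poly R}) :
  a != 0 -> b != 0 ->
  u = a *: \prod_(x <- A) ('X - x%:P) -> v = b *: \prod_(y <- B) ('X - y%:P) ->
  Res u v = a ^+ size B * b ^+ size A * \prod_(x <- A) \prod_(y <- B) (x - y).
Proof.
move=> a0 b0 uE vE.
have su : (size u).-1 = size A by rewrite uE size_scale // size_prod_XsubC.
have sv : (size v).-1 = size B by rewrite vE size_scale // size_prod_XsubC.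
rewrite /Res resultant_Syl su sv {1}uE Syl_prod; last by rewrite -sv; case: size.
rewrite !mulrA -exprD mulnC addnn -mul2n exprM sqrrN !expr1n mul1r.
rewrite -mulrA; congr (_ * _).
have -> : b ^+ size A = \prod_(x <- A) b.
  by rewrite big_const_seq count_predT iter_mulr_1.
rewrite -big_split /=; apply: eq_bigr => x _.
rewrite vE hornerZ horner_prod; congr (_ * _); apply: eq_bigr => y _.
by rewrite !hornerE.
Qed.

Lemma map_Res (R S : nzRingType) (j : {rmorphism R -> S}) (u v : {poly R}) :
  injective j -> j (Res u v) = Res (map_poly j u) (map_poly j v).
Proof.
move=> ji; rewrite /Res !resultant_Syl !(size_map_inj_poly ji (rmorph0 j)).
rewrite rmorphM rmorphXn rmorphN1 -det_map_mx; congr (_ * \det _).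
apply/matrixP=> i k; rewrite !mxE -coef_map; congr _`__.
by case: ifP => _; rewrite rmorphM /= map_polyXn.
Qed.

(* The product formula over a domain S where both polynomials split; for
   R = {poly K}, S can be an algebraic closure of K(t). *)
Lemma Res_roots (R S : idomainType) (j : {rmorphism R -> S})
  (A B : seq S) (u v : {poly R}) :
  injective j -> u != 0 -> v != 0 ->
  map_poly j u = j (lead_coef u) *: \prod_(x <- A) ('X - x%:P) ->
  map_poly j v = j (lead_coef v) *: \prod_(y <- B) ('X - y%:P) ->
  j (Res u v) =
    j (lead_coef u) ^+ (size v).-1 * j (lead_coef v) ^+ (size u).-1 *
    \prod_(x <- A) \prod_(y <- B) (x - y).
Proof.
move=> ji u0 v0 uE vE.
have j0 x : x != 0 -> j x != 0 by move=> x0; rewrite -(rmorph0 j) (inj_eq ji).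
have a0 : j (lead_coef u) != 0 by rewrite j0 // lead_coef_eq0.
have b0 : j (lead_coef v) != 0 by rewrite j0 // lead_coef_eq0.
rewrite map_Res // (Res_split a0 b0 uE vE).
rewrite -(size_map_inj_poly ji (rmorph0 j) u) uE.
rewrite -(size_map_inj_poly ji (rmorph0 j) v) vE.
by rewrite !size_scale // !size_prod_XsubC.
Qed.

(* Main.v *)
(* If f = g o h with g and h rational, a pole argument (carried out on the
   homogenized numerator and denominator of g) gives f = P o q with P and q
   polynomials of the same degrees m and k >= 2 as g and h.  Up to a nonzero
   constant, D[f - t] is the product of the factors f(x) - t over the roots x
   of f' = P'(q) q'.  A root of P'(q) lies in a whole fibre of q, which makes the
   corresponding critical value multiple.  So the simple critical values are
   among the images of the at most k - 1 roots of q', and k - 1 < k <= d. *)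
Require Import Defs.
From mathcomp Require Import all_boot all_order all_algebra.
From mathcomp Require Import perm ring zify.

Set Implicit Arguments.
Unset Strict Implicit.
Unset Printing Implicit Defensive.

Import GRing.Theory.
Local Open Scope ring_scope.

(** * Coefficients of products and powers at degree bounds *)

Section TopCoefficient.
Variable R : comNzRingType.
Implicit Types u v : {poly R}.

Lemma size_polyM_top u v a b : (size u <= a.+1)%N -> (size v <= b.+1)%N ->
  (size (u * v)%R <= (a + b).+1)%N.
Proof.
move=> su sv; rewrite (leq_trans (size_polyMleq _ _)) // -subn1 leq_subLR add1n.
by rewrite -addSn -addnS leq_add.
Qed.

Lemma coefM_top u v a b : (size u <= a.+1)%N -> (size v <= b.+1)%N ->
  (u * v)`_(a + b) = u`_a * v`_b.
Proof.
move=> su sv; have ab : (a < (a + b).+1)%N by lia.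
rewrite coefM (bigD1 (Ordinal ab)) //= addKn big1 ?addr0 // => i.
rewrite -val_eqE /= => ia; case: (ltngtP i a) ia => // ia _.
  by rewrite [X in _ * X]nth_default ?mulr0 // (leq_trans sv) //; lia.
by rewrite [X in X * _]nth_default ?mul0r // (leq_trans su) //; lia.
Qed.

Lemma coefX_top u k i : (size u <= k.+1)%N -> (u ^+ i)`_(k * i) = u`_k ^+ i.
Proof.
move=> su; elim: i => [|i IHi]; first by rewrite muln0 !expr0 coef1.
rewrite !exprS mulnS coefM_top ?IHi // (leq_trans (size_poly_exp_leq _ _)) //.
by rewrite ltnS leq_mul //; lia.
Qed.

End TopCoefficient.

(** * Homogenized substitution of a fraction into a polynomial *)

Section Homogenization.
Variable K : fieldType.
Implicit Types g u v : {poly K}.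

(** When [m] bounds the degree of [g], this is [v ^+ m] times the value of [g] at [u / v]. Keeping
    [m] independent of [g] lets a numerator and a denominator share one power of [v]. *)
Definition homog m g u v : {poly K} :=
  \sum_(i < m.+1) g`_i *: (u ^+ i * v ^+ (m - i)).

(** Identities between homogenizations can thus be checked in the fraction field, where evaluation
    is a ring morphism. *)
Lemma homog_tofrac m g u v : (size g <= m.+1)%N -> v != 0 ->
  (homog m g u v)%:F = v%:F ^+ m * reval g (u%:F / v%:F).
Proof.
move=> sg v0; have vF : v%:F != 0 by rewrite tofrac_eq0.
rewrite /homog /reval (horner_coef_wide _ (leq_trans (size_poly _ _) sg)).
rewrite rmorph_sum mulr_sumr; apply: eq_bigr => i _.
rewrite coef_map /= -mul_polyC !rmorphM !rmorphXn /= [RHS]mulrCA; congr (_ * _).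
have -> : v%:F ^+ m = v%:F ^+ (m - i) * v%:F ^+ i by rewrite -exprD subnK ?leq_ord.
rewrite expr_div_n -mulrA [X in _ = _ * X]mulrCA mulfV ?expf_neq0 // mulr1.
by rewrite mulrC.
Qed.

Lemma homogM m n g1 g2 u v : (size g1 <= m.+1)%N -> (size g2 <= n.+1)%N ->
  v != 0 -> homog (m + n) (g1 * g2) u v = homog m g1 u v * homog n g2 u v.
Proof.
move=> s1 s2 v0; apply/eqP; rewrite -tofrac_eq tofracM !homog_tofrac //.
  by rewrite /reval rmorphM hornerM exprD mulrACA.
exact: size_polyM_top.
Qed.

Lemma homog_low m j g u v : (size g <= j.+1)%N -> (j <= m)%N -> v != 0 ->
  homog m g u v = v ^+ (m - j) * homog j g u v.
Proof.
move=> sg jm v0; apply/eqP; rewrite -tofrac_eq tofracM !homog_tofrac //.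
  by rewrite tofracXn mulrA -exprD subnK.
exact: leq_trans sg _.
Qed.

Lemma size_homog m g u v k : (size u <= k.+1)%N -> (size v <= k.+1)%N ->
  (size (homog m g u v) <= (k * m).+1)%N.
Proof.
move=> su sv; rewrite (leq_trans (size_sum _ _ _)) //.
apply/bigmax_leqP => i _; rewrite (leq_trans (size_scale_leq _ _)) //.
rewrite (leq_trans (size_polyMleq _ _)) //.
have := size_poly_exp_leq u i; have := size_poly_exp_leq v (m - i).
have im : (i <= m)%N := leq_ord i.
have : ((size u).-1 * i <= k * i)%N by rewrite leq_mul //; lia.
have : ((size v).-1 * (m - i) <= k * (m - i))%N by rewrite leq_mul //; lia.
rewrite mulnBr; have : (k * i <= k * m)%N by rewrite leq_mul.
lia.
Qed.

Lemma coef_homog m g u v k : (size u <= k.+1)%N -> (size v <= k.+1)%N ->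
  (homog m g u v)`_(k * m) = \sum_(i < m.+1) g`_i * (u`_k ^+ i * v`_k ^+ (m - i)).
Proof.
move=> su sv; rewrite coef_sum; apply: eq_bigr => i _; rewrite coefZ.
have -> : (k * m = k * i + k * (m - i))%N by rewrite -mulnDr subnKC ?leq_ord.
rewrite coefM_top ?coefX_top //.
  by rewrite (leq_trans (size_poly_exp_leq _ _)) // ltnS leq_mul // -subn1 leq_subLR.
by rewrite (leq_trans (size_poly_exp_leq _ _)) // ltnS leq_mul // -subn1 leq_subLR.
Qed.

(** Only the term [i = m] reaches degree [k * m], since [v] has degree below [k]. *)
Lemma size_homog_lt m g u v k : size u = k.+1 -> (size v <= k)%N ->
  size g = m.+1 -> size (homog m g u v) = (k * m).+1.
Proof.
move=> su sv sg; apply/eqP; rewrite eqn_leq size_homog ?su ?(leqW sv) //=.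
rewrite ltnNge; apply: contraTN isT => H.
have /eqP : (homog m g u v)`_(k * m) = 0 by rewrite nth_default.
rewrite coef_homog ?su ?(leqW sv) // big_ord_recr /= subnn expr0 mulr1.
rewrite big1 => [|i _].
  have /= ck := lead_coefE u; have cm := lead_coefE g.
  rewrite su in ck; rewrite sg in cm; rewrite /= in ck cm.
  rewrite add0r -ck -cm mulf_eq0 expf_eq0 !lead_coef_eq0 -!size_poly_eq0 su sg.
  by rewrite /= andbF.
by rewrite [v`_k]nth_default // expr0n subn_eq0 leqNgt ltn_ord /= !mulr0.
Qed.

(** Here [r] is the value of [u / v] at infinity; the coefficient in degree [k * m] is [g.[r]] times
    the [m]-th power of the leading coefficient of [v]. *)
Lemma size_homog_root m g u v k r : (size u <= k.+1)%N -> size v = k.+1 ->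
  u`_k = r * v`_k -> (size g <= m.+1)%N -> g.[r] != 0 ->
  size (homog m g u v) = (k * m).+1.
Proof.
move=> su sv ur sg gr; apply/eqP; rewrite eqn_leq size_homog ?sv //=.
rewrite ltnNge; apply: contra gr => H.
have : (homog m g u v)`_(k * m) = 0 by rewrite nth_default.
rewrite coef_homog ?sv // (eq_bigr (fun i : 'I_m.+1 => v`_k ^+ m * (g`_i * r ^+ i))).
  rewrite -mulr_sumr -horner_coef_wide // => /eqP; rewrite mulf_eq0 expf_eq0.
  have /= ck := lead_coefE v; rewrite sv /= in ck.
  by rewrite -ck lead_coef_eq0 -size_poly_eq0 sv andbF.
move=> i _; rewrite ur exprMn.
have -> : v`_k ^+ m = v`_k ^+ i * v`_k ^+ (m - i) by rewrite -exprD subnKC ?leq_ord.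
by ring.
Qed.

(** Modulo [v] only the term [i = m] survives, a nonzero multiple of [u ^+ m]. *)
Lemma coprimep_homog m g u v : v != 0 -> coprimep u v -> g`_m != 0 ->
  coprimep (homog m g u v) v.
Proof.
move=> v0 uv gm; rewrite /homog big_ord_recr /= subnn expr0 mulr1.
have -> : \sum_(i < m) g`_i *: (u ^+ i * v ^+ (m - i)) =
  (\sum_(i < m) g`_i *: (u ^+ i * v ^+ (m - i).-1)) * v.
  rewrite mulr_suml; apply: eq_bigr => i _; rewrite -scalerAl -mulrA -exprSr.
  by rewrite prednK // subn_gt0.
rewrite coprimep_sym coprimep_addl_mul coprimepZr //.
by rewrite coprimep_expr // coprimep_sym.
Qed.

(** By a homogenized Bezout relation, the homogenization of [g2] divides a power of [v]; being also
    coprime to [v], it is constant. *)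
Lemma homog_coprime_dvd m g1 g2 u v : v != 0 -> coprimep u v ->
  (size g1 <= m.+1)%N -> (size g2 <= m.+1)%N ->
  (g1`_m != 0) || (g2`_m != 0) -> coprimep g1 g2 ->
  homog m g2 u v %| homog m g1 u v -> size (homog m g2 u v) = 1%N.
Proof.
move=> v0 uv s1 s2 gm /Bezout_coprimepP [[a b] /= /eqpf_eq [c c0 E]] dvd.
pose M := maxn (size a) (size b).
have sa : (size a <= M.+1)%N by rewrite leqW ?leq_maxl.
have sb : (size b <= M.+1)%N by rewrite leqW ?leq_maxr.
have B : homog M a u v * homog m g1 u v + homog M b u v * homog m g2 u v =
    c *: v ^+ (M + m).
  rewrite -!homogM //; apply/eqP; rewrite -tofrac_eq tofracD.
  rewrite !homog_tofrac ?size_polyM_top //.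
  rewrite -mulrDr -hornerD /reval -rmorphD E alg_polyC /= map_polyC /=.
  by rewrite hornerC -mul_polyC tofracM tofracXn mulrC.
(* If it is [g1] that has degree [m], coprimality to [v] passes from its homogenization to the
   divisor. *)
have cop : coprimep (homog m g2 u v) v.
  case/orP: gm => gm; last exact: coprimep_homog.
  by apply: coprimep_dvdr dvd _; apply: coprimep_homog.
have : homog m g2 u v %| v ^+ (M + m).
  rewrite -(dvdpZr _ _ c0) -B dvdp_add //; last by rewrite dvdp_mulIr.
  by rewrite dvdp_mull.
by rewrite -[X in _ %| X]mulr1 Gauss_dvdpr ?coprimep_expr // dvdp1 => /eqP.
Qed.

(* If [deg v < deg u], then [g2] and [v] must be constant.  Otherwise let [r] be
   the value of [u / v] at infinity and [g2 = ('X - r) ^+ j * q] with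
   [q.[r] != 0]: comparing degrees, [j = m] and [u - r v] is constant, so [f] is
   a polynomial in [v]. *)
Lemma homog_const_decomposition m k g1 g2 u v f :
  (1 < m)%N -> (1 < k)%N -> v != 0 -> maxn (size g1) (size g2) = m.+1 ->
  maxn (size u) (size v) = k.+1 -> coprimep g1 g2 ->
  size (homog m g2 u v) = 1%N -> f * homog m g2 u v = homog m g1 u v ->
  exists P h, [/\ f = P \Po h, size h = k.+1 & size f = (k * m).+1].
Proof.
move=> m1 k1 v0 gm uvk g12 /eqP/size_poly1P [c c0 E]; rewrite E => fE.
have s1 : (size g1 <= m.+1)%N by rewrite -gm leq_maxl.
have s2 : (size g2 <= m.+1)%N by rewrite -gm leq_maxr.
have su : (size u <= k.+1)%N by rewrite -uvk leq_maxl.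
have {}fE : f = c^-1 *: homog m g1 u v.
  by rewrite -fE mulrC mul_polyC scalerA mulVf ?scale1r.
have sf : size f = size (homog m g1 u v) by rewrite fE size_scale ?invr_eq0.
have c1 : size (c%:P : {poly K}) = 1%N by rewrite size_polyC c0.
have g20 : g2 != 0.
  apply: contraNneq c0 => g20; rewrite -(polyC_eq0 c) -E g20.
  by rewrite /homog big1 // => i _; rewrite coef0 scale0r.
have [uv|vu] := ltnP (size v) (size u).
  have su' : size u = k.+1 by move: uvk; rewrite (maxn_idPl (ltnW uv)).
  have sv : (size v <= k)%N by rewrite -ltnS -su'.
  pose j := (size g2).-1.
  have sj : size g2 = j.+1 by rewrite polySpred.
  have jm : (j <= m)%N by rewrite -ltnS -sj.
  (* The degrees of the two factors give [(m - j) * deg v + k * j = 0], hence [j = 0] and then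
     [deg v = 0]. *)
  have := c1; rewrite -E (homog_low u _ jm v0) ?sj // size_mul; last 2 first.
  - by rewrite expf_neq0.
  - by rewrite -size_poly_eq0 (size_homog_lt su' sv sj).
  rewrite (size_homog_lt su' sv sj) addnS /= => H.
  have j0 : j = 0%N.
    have := H; rewrite (polySpred (expf_neq0 _ v0)) addSn => -[] /eqP.
    by rewrite addn_eq0 muln_eq0 => /andP[_ /orP[/eqP k0|/eqP//]]; rewrite k0 in k1.
  have sv1 : size v = 1%N.
    have := H; rewrite j0 muln0 addn0 subn0 (polySpred (expf_neq0 _ v0)) size_exp.
    move=> -[] /eqP; rewrite muln_eq0 => /orP[]/eqP H0; last by rewrite H0 in m1.
    by rewrite (polySpred v0) H0.
  have sg1 : size g1 = m.+1.
    move: gm; rewrite sj j0 => /eqP; rewrite /maxn; case: ifP => _ /eqP //.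
    by case: (m) m1.
  have /eqP/size_poly1P [e e0 ve] := sv1.
  (* As [v] is the constant [e], the homogenization of [g1] is a polynomial in [u]. *)
  exists (c^-1 *: \sum_(i < m.+1) g1`_i *: ('X ^+ i * e%:P ^+ (m - i))), u.
  split=> //.
    rewrite fE comp_polyZ; congr (_ *: _).
    rewrite /homog ve rmorph_sum; apply: eq_bigr => i _ /=.
    by rewrite comp_polyZ rmorphM !rmorphXn /= comp_polyX comp_polyC.
  by rewrite sf (size_homog_lt su' sv sg1).
have sv : size v = k.+1 by move: uvk; rewrite (maxn_idPr vu).
pose r := u`_k / v`_k.
have vk0 : v`_k != 0.
  by have := lead_coefE v; rewrite sv /= => <-; rewrite lead_coef_eq0.
have ur : u`_k = r * v`_k by rewrite divfK.
have [j [q q0 g2E]] := multiplicity_XsubC g2 r; rewrite g20 /= in q0.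
have sg2 : size g2 = (size q + j)%N.
  have qn0 : q != 0 by apply: contraNneq q0 => ->; rewrite root0.
  by rewrite g2E size_Mmonic ?monic_exp ?monicXsubC // size_exp_XsubC addnS.
have jm : (j <= m)%N.
  rewrite -ltnS (leq_trans _ s2) // sg2 -[X in (X < _)%N]add0n.
  rewrite ltn_add2r size_poly_gt0.
  by apply: contraNneq q0 => ->; rewrite root0.
have sq : (size q <= (m - j).+1)%N by rewrite -(leq_add2r j) addSn subnK // -sg2.
have hX : homog j (('X - r%:P) ^+ j) u v = (u - r *: v) ^+ j.
  elim: j {g2E sg2 jm sq} => [|j IHj].
    by rewrite !expr0 /homog big_ord1 coef1 scale1r !expr0 mulr1.
  rewrite !exprSr -addn1 homogM ?size_exp_XsubC ?size_XsubC // IHj; congr (_ * _).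
  rewrite /homog !big_ord_recl big_ord0 /= !coefB !coefX !coefC /= !expr0 !expr1.
  by rewrite sub0r subr0 mul1r mulr1 scale1r addr0 scaleNr addrC.
have E2 : homog m g2 u v = (u - r *: v) ^+ j * homog (m - j) q u v.
  rewrite g2E mulrC -[X in homog X](subnKC jm) homogM ?size_exp_XsubC //.
  by rewrite hX.
have sh := size_homog_root su sv ur sq q0.
have h0 : homog (m - j) q u v != 0 by rewrite -size_poly_eq0 sh.
have w0 : (u - r *: v) ^+ j != 0.
  by apply: contraNneq c0 => w0; rewrite -(polyC_eq0 c) -E E2 w0 mul0r.
(* Now [j * deg (u - r v) + k * (m - j) = 0], so [j = m], and [u - r v] is constant because
   [m > 0]. *)
have := c1; rewrite -E E2 size_mul // sh addnS /= (polySpred w0) addSn => -[] /eqP.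
rewrite addn_eq0 muln_eq0 size_exp muln_eq0 => /andP[H].
have -> : (k == 0)%N = false by case: (k) k1.
rewrite subn_eq0 /= => mj; have {mj} jE : j = m by apply/eqP; rewrite eqn_leq jm.
move: H w0; rewrite jE expf_eq0 (ltnW m1) (gtn_eqF (ltnW m1)) orbF /= => H w0.
have {H} : size (u - r *: v) == 1%N by rewrite (polySpred w0) (eqP H).
case/size_poly1P => e e0 ue.
(* Since [j = m > 0], [r] is a root of [g2], hence not of the coprime [g1]; this gives [f] the full
   degree [k * m]. *)
have g1r : g1.[r] != 0.
  apply: contraTneq g12 => g1r; apply/negP => /coprimep_root/(_ (introT rootP g1r)).
  rewrite g2E jE hornerM horner_exp !hornerE subrr expr0n.
  by case: (m) m1 => //= ?; rewrite mulr0 eqxx.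
(* The witness comes from substituting [u = e + r v]. *)
exists (c^-1 *: \sum_(i < m.+1) g1`_i *: ((e%:P + r *: 'X) ^+ i * 'X^(m - i))), v.
split=> //; last by rewrite sf (size_homog_root su sv ur s1 g1r).
rewrite fE comp_polyZ; congr (_ *: _).
rewrite /homog rmorph_sum; apply: eq_bigr => i _ /=.
rewrite comp_polyZ rmorphM !rmorphXn /= comp_polyX comp_polyD comp_polyC.
by rewrite comp_polyZ comp_polyX -ue subrK.
Qed.

End Homogenization.

(** * From rational to polynomial decompositions *)

(** Clearing denominators shows that the homogenized denominator of [g] divides the homogenized
    numerator, so it is constant by [homog_coprime_dvd]. *)
Lemma rcomp_polynomial_decomposition (K : fieldType) (f : {poly K})
    (g h : {fraction {poly K}}) :
  (1 < size f)%N -> f%:F = rcomp g h -> (1 < rdeg g)%N -> (1 < rdeg h)%N ->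
  exists P q, [/\ f = P \Po q, (size q).-1 = rdeg h &
                 (size f).-1 = (rdeg h * rdeg g)%N].
Proof.
move=> f1 fE g2 h2.
have [dg0 gcop _] := rnum_rden g; have [dh0 hcop hE] := rnum_rden h.
set m := rdeg g in g2 *; set k := rdeg h in h2 *.
have succ (p q : {poly K}) : q != 0 ->
    maxn (size p) (size q) = (maxn (size p).-1 (size q).-1).+1.
  move=> q0; rewrite (polySpred q0) /=.
  by case: (size p) => [|n]; rewrite ?max0n ?maxnSS.
have mE := succ (rnum g) _ dg0; have kE := succ (rnum h) _ dh0.
rewrite -/(rdeg g) -/m in mE; rewrite -/(rdeg h) -/k in kE.
have s1 : (size (rnum g) <= m.+1)%N by rewrite -mE leq_maxl.
have s2 : (size (rden g) <= m.+1)%N by rewrite -mE leq_maxr.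
(* Otherwise [rcomp g h] would be 0, as the inverse of 0 is 0, while [f] is not constant. *)
have r0 : reval (rden g) h != 0.
  apply: contraTneq f1 => r0; move: fE; rewrite /rcomp r0 invr0 mulr0 => /eqP.
  by rewrite tofrac_eq0 => /eqP->; rewrite size_poly0.
have E : f * homog m (rden g) (rnum h) (rden h) = homog m (rnum g) (rnum h) (rden h).
  apply/eqP; rewrite -tofrac_eq tofracM !homog_tofrac // -hE fE /rcomp.
  by rewrite mulrCA divfK.
have top : ((rnum g)`_m != 0) || ((rden g)`_m != 0).
  have lc (p : {poly K}) : size p = m.+1 -> p`_m != 0.
    by move=> sp; rewrite -[m]/(m.+1.-1) -sp -lead_coefE lead_coef_eq0
      -size_poly_eq0 sp.
  by move: mE; rewrite /maxn; case: ifP => _ /lc ->; rewrite ?orbT.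
have sd : size (homog m (rden g) (rnum h) (rden h)) = 1%N.
  by apply: homog_coprime_dvd top gcop _ => //; rewrite -E dvdp_mull.
have [P [q [-> sq sf]]] := homog_const_decomposition g2 h2 dh0 mE kE gcop sd E.
by exists P, q; rewrite sq sf.
Qed.

(** * Discriminant of [f - t] and critical values of compositions *)

(** The two matrices differ by exchanging their blocks of rows. The sign is left unspecified because
    the discriminant is only needed up to a constant. *)
Lemma det_Syl_swap (R : comNzRingType) l n (p q : {poly R}) :
  exists b : bool, \det (Syl (l + n) l p q) = (-1) ^+ b * \det (Syl (l + n) n q p).
Proof.
have swapP (i : 'I_(l + n)) : ((if i < l then i + n else i - l) < l + n)%N.
  by have := ltn_ord i; case: (ltnP i l); lia.
pose sw i := Ordinal (swapP i).
have sw_inj : injective sw.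
  move=> i j /(congr1 val) /= ij; apply: val_inj => /=; move: ij.
  by have := ltn_ord i; have := ltn_ord j; case: (ltnP i l); case: (ltnP j l); lia.
exists (odd_perm (perm sw_inj)); rewrite -det_perm -det_mulmx -row_permE.
congr (\det _); apply/matrixP=> i j; rewrite !mxE permE /=.
have := ltn_ord i; case: (ltnP i l) => il iN.
  by rewrite ltnNge leq_addl addnK.
by have -> : (i - l < n)%N by lia.
Qed.

Lemma map_Syl (R S : nzRingType) (j : {rmorphism R -> S}) N l (p q : {poly R}) :
  map_mx j (Syl N l p q) = Syl N l (map_poly j p) (map_poly j q).
Proof.
apply/matrixP=> i k; rewrite !mxE -coef_map; congr _`__.
by case: ifP => _; rewrite rmorphM /= map_polyXn.
Qed.

Section DiscriminantRoots.
Variables (K L : fieldType) (iota : {rmorphism K -> L}) (f : {poly K}).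
Local Notation "p ^i" := (map_poly iota p) (at level 2).

(** [Syl_prod] needs only its first argument to split, so the derivative is moved there and [f - t]
    itself need not split. *)
Lemma discr_subt_roots (a : L) (s : seq L) :
  (1 < size f)%N -> size s = (size f^`()).-1 ->
  (f^`())^i = a *: \prod_(x <- s) ('X - x%:P) ->
  exists c : L, (discr_subt f)^i = c *: \prod_(x <- s) ((f^i).[x]%:P - 'X).
Proof.
move=> f1 ss f'E; set u := f^:P - 'X%:P.
have su : size u = size f.
  rewrite size_polyDl ?(size_map_inj_poly (@polyC_inj _)) //.
  by rewrite size_polyN size_polyC polyX_eq0.
have u'E : u^`() = (f^`())^:P by rewrite derivB derivC subr0 deriv_map.
have su' : size u^`() = size f^`() by rewrite u'E (size_map_inj_poly (@polyC_inj _)).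
have uLE : map_poly (map_poly iota) u = (f^i)^:P - 'X%:P.
  rewrite rmorphB /= map_polyC /= map_polyX -!map_poly_comp.
  by congr (_ - _); apply: eq_map_poly => x /=; rewrite map_polyC.
have u'LE : map_poly (map_poly iota) u^`() =
    a%:P *: \prod_(x <- map polyC s) ('X - x%:P).
  rewrite u'E -map_poly_comp -[RHS](_ : map_poly polyC (f^`())^i = _).
    by rewrite -map_poly_comp; apply: eq_map_poly => x /=; rewrite map_polyC.
  rewrite f'E map_polyZ rmorph_prod big_map; congr (_ *: _).
  by apply: eq_bigr => x _; rewrite rmorphB /= map_polyX map_polyC.
rewrite /discr_subt -/u /discr lead_coef_subt // -/u /Res resultant_Syl su su'.
have [b ->] := det_Syl_swap (size f^`()).-1 (size f).-1 u u^`().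
rewrite polyCV -!(rmorphN1 polyC) -!rmorphXn -rmorphM !mulrA -!rmorphM /=.
rewrite mul_polyC map_polyZ -det_map_mx map_Syl u'LE uLE.
rewrite addnC -ss -(size_map polyC s) Syl_prod; last first.
  by rewrite -uLE (leq_trans (size_poly _ _)) // su leqSpred.
rewrite -(rmorphN1 polyC) -!rmorphXn -rmorphM /= mul_polyC scalerA; eexists.
congr (_ *: _); rewrite big_map; apply: eq_bigr => x _.
by rewrite hornerD hornerN hornerC horner_map.
Qed.

End DiscriminantRoots.

(* A root [x] of [q - beta], with [beta] a root of [P^`()], is one of
   [deg q >= 2] roots of [(P \Po q)^`()] at which [P \Po q] takes the value
   [P.[beta]], so that value is a multiple critical value. *)
Lemma simple_critical_value_comp (K : fieldType) (L : closedFieldType)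
    (iota : {rmorphism K -> L}) (P q : {poly K}) (a : L) (S : seq L) (b : L) :
  (1 < size (P \Po q))%N -> (2 < size q)%N ->
  map_poly iota q^`() = a *: \prod_(x <- S) ('X - x%:P) ->
  simple_critical_value iota (P \Po q) b ->
  exists2 x, x \in S & b = (map_poly iota (P \Po q)).[x].
Proof.
move=> sf sq q'E []; rewrite /critical_value.
set f := P \Po q in sf *; set D := map_poly iota (discr_subt f) => Db mD.
have D0 : D != 0.
  have : (mup b D <= size D)%N by rewrite /mup leq_ord.
  by rewrite mD size_poly_gt0.
have f'0 : f^`() != 0.
  apply: contraNneq D0 => f'0.
  (* With [a = 0] and no roots, [D] is a constant vanishing at [b], hence zero. *)
  have [||c DE] := @discr_subt_roots K L iota f 0 [::] sf; rewrite ?f'0.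
  - by rewrite size_poly0.
  - by rewrite rmorph0 scale0r.
  move: Db; rewrite -/D in DE *; rewrite DE big_nil rootE hornerZ hornerC mulr1.
  by move/eqP->; rewrite scale0r.
pose Q := map_poly iota q.
have sQ : size Q = size q by rewrite size_map_poly.
have [T TE] := closed_field_poly_normal (map_poly iota P^`()).
pose R be := sval (closed_field_poly_normal (Q - be%:P)).
have szC (be : L) : (size (- be%:P : {poly L}) < size Q)%N.
  rewrite size_polyN (leq_ltn_trans (size_polyC_leq1 _)) // sQ.
  exact: leq_trans sq.
have RE be : Q - be%:P = lead_coef Q *: \prod_(x <- R be) ('X - x%:P).
  rewrite -(lead_coefDl (szC be)).
  exact: svalP (closed_field_poly_normal (Q - be%:P)).
have Q0 : lead_coef Q != 0 by rewrite lead_coef_eq0 -size_poly_gt0 sQ; case: size sq.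
have sR be : (1 < size (R be))%N.
  rewrite -ltnS -(size_prod_XsubC _ id) -(size_scale _ Q0) -RE size_polyDl // sQ.
  exact: sq.
(* By the chain rule, the roots of the derivative of [f] are the fibres of [Q] over the roots of
   [P^]()[, followed by the roots of]q^[()]. *)
pose s := flatten (map R T) ++ S.
have [e f'E] : exists e, map_poly iota f^`() = e *: \prod_(x <- s) ('X - x%:P).
  rewrite deriv_comp rmorphM /= map_comp_poly q'E TE comp_polyZ rmorph_prod /=.
  rewrite big_cat big_flatten big_map /=.
  rewrite (eq_bigr (fun be => lead_coef Q *: \prod_(x <- R be) ('X - x%:P))).
    by rewrite scaler_prod -scalerAl -scalerAr -scalerAl !scalerA; eexists.
  by move=> be _; rewrite rmorphB /= comp_polyX comp_polyC RE.
have e0 : e != 0.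
  apply: contraNneq f'0 => e0; rewrite -(map_poly_eq0 iota).
  by rewrite f'E e0 scale0r.
have ss : size s = (size f^`()).-1.
  by rewrite -(size_map_poly iota) f'E size_scale // size_prod_XsubC.
have [c DE] := discr_subt_roots sf ss f'E.
have c0 : c != 0 by apply: contraNneq D0 => c0; rewrite /D DE c0 scale0r.
move: Db; rewrite /D DE rootE hornerZ horner_prod mulf_eq0 (negPf c0).
rewrite prodf_seq_eq0 => /hasP[x xs] /=; rewrite !hornerE subr_eq0 => /eqP bE.
move: xs; rewrite mem_cat => /orP[|xS]; last by exists x.
case/flattenP=> _ /mapP[be beT ->] xR.
have fR z : z \in R be -> (map_poly iota f).[z] = (map_poly iota P).[be].
  move=> zR; rewrite map_comp_poly horner_comp; congr _.[_].
  apply/eqP; rewrite -subr_eq0 -/Q; have /(congr1 (fun p => p.[z])) := RE be.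
  rewrite !hornerE horner_prod => ->; rewrite mulf_eq0 prodf_seq_eq0.
  by apply/orP; right; apply/hasP; exists z; rewrite //= !hornerE subrr.
(* Each of the at least two points of the fibre over [be] contributes a factor [b%:P - 'X] to [D],
   against multiplicity 1. *)
suff : ('X - b%:P) ^+ 2 %| D by rewrite -(mup_geq _ _ D0) mD.
rewrite /D DE dvdpZr // big_cat big_flatten big_map (big_rem be) //= -mulrA.
rewrite dvdp_mulr // (eq_big_seq (fun=> b%:P - 'X)); last first.
  by move=> z zR; rewrite -bE !fR.
rewrite big_const_seq count_predT iter_mulr_1 -(subnK (sR be)) exprD.
by rewrite dvdp_mull // -sqrrN opprB.
Qed.

Theorem theorem4p3 (K : fieldType) (Kbar : closedFieldType)
  (iota : {rmorphism K -> Kbar}) (hKbar : is_algebraic_closure iota)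
  (f : {poly K}) (d : nat)
  (hd : greatest_proper_divisor d (size f).-1)
  (hf : at_least_simple_critical_values iota f d) :
  prime_over f%:F.
Proof.
move=> [g [h [fE g2 h2]]].
have [_ _ dn dmax] := hd; have [s [us sd scv]] := hf.
have f1 : (1 < size f)%N by case: (size f) dn => [|[|n]] //=; lia.
have [P [q [fPq sq sf]]] := rcomp_polynomial_decomposition f1 fE g2 h2.
have kd : (rdeg h <= d)%N.
  apply: dmax; [exact: ltnW | by rewrite sf dvdn_mulr |].
  by rewrite sf -[X in (X < _)%N]muln1 ltn_pmul2l // ltnW.
have q2 : (2 < size q)%N by move: h2; rewrite -sq; case: (size q).
have [a [S [q'E sS]]] : exists a S,
    map_poly iota q^`() = a *: \prod_(x <- S) ('X - x%:P) /\ (size S < rdeg h)%N.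
  (* A zero derivative, possible in positive characteristic, takes the empty list;
     [simple_critical_value_comp] then excludes every simple critical value. *)
  have [->|q'0] := eqVneq q^`() 0.
    by exists 0, [::]; rewrite rmorph0 scale0r ltnW.
  have [S q'E] := closed_field_poly_normal (map_poly iota q^`()).
  exists (lead_coef (map_poly iota q^`())), S; split=> //.
  rewrite -ltnS -(size_prod_XsubC _ id).
  rewrite -(@size_scale _ (lead_coef (map_poly iota q^`()))); last first.
    by rewrite lead_coef_eq0 map_poly_eq0.
  rewrite -q'E size_map_poly -sq; have qn0 : q != 0.
    by rewrite -size_poly_gt0; case: size q2.
  by rewrite prednK ?size_poly_gt0 // lt_size_deriv.
(* The distinct values in [s] all lie among the images of [S], so
   [d <= size s <= size S < rdeg h <= d]. *)
have : (size s <= size [seq (map_poly iota f).[x] | x <- S])%N.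
  apply: uniq_leq_size => // b /scv; rewrite fPq in f1 *.
  by case/(simple_critical_value_comp f1 q2 q'E) => x xS ->; apply: map_f.
by rewrite size_map leqNgt (leq_trans sS) // (leq_trans kd sd).
Qed.
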